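(* Let $\sigma\in\mathbb{C}$ and let $\tilde H\in\mathbb{R}^{\mathcal I_N\times\mathcal I_N}$ be strictly lower triangular. Then $\kappa(\sigma,\tilde H)=\kappa(\sigma,\tilde H^A)$.
   Context: $N\ge1$ is an integer and $\mathcal I_N=\{0,1,\dots,N\}$ indexes rows and columns. $\mathbb{1}$ is the all-ones vector, $e_N$ is the last standard basis vector, $S\in\mathbb{R}^{\mathcal I_N\times\mathcal I_N}$ has ones on and below the diagonal and zeros elsewhere, and $R$ is the reversal permutation matrix (ones on the antidiagonal). The antitranspose is $\tilde H^A=R\tilde H^\intercal R$. Define $\kappa(\sigma,\tilde H)=e_N^\intercal(I+\sigma S\tilde H)^{-1}\mathbb{1}$. *)

(* Defs.v *)
From HB Require Import structures.
From mathcomp Require Import all_boot all_order all_algebra.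
From mathcomp Require Import reals.
From mathcomp.real_closed Require Import complex.

(* The reals are an arbitrary [R : realType], the complex numbers are [R[i]],
   and the index set {0, ..., N} is ['I_N.+1]. *)

Set Implicit Arguments.
Unset Strict Implicit.
Unset Printing Implicit Defensive.

Import Order.TTheory GRing.Theory Num.Theory.
Local Open Scope ring_scope.
Local Open Scope complex_scope.

Definition onesv (F : nzRingType) (N : nat) : 'cV[F]_N.+1 := const_mx 1.

Definition last_basis (F : nzRingType) (N : nat) : 'cV[F]_N.+1 :=
  delta_mx ord_max 0.

Definition Smx (F : nzRingType) (N : nat) : 'M[F]_N.+1 :=
  \matrix_(i, j) (j <= i)%N%:R.

Definition revmx (F : nzRingType) (N : nat) : 'M[F]_N.+1 :=
  \matrix_(i, j) (j == rev_ord i)%:R.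

Definition antitr (F : nzRingType) (N : nat) (H : 'M[F]_N.+1) : 'M[F]_N.+1 :=
  revmx F N *m H^T *m revmx F N.

(* [is_trig_mx] only says "lower triangular"; here the diagonal vanishes too. *)
Definition strictly_lower (F : nzRingType) (N : nat) (H : 'M[F]_N.+1) : Prop :=
  forall i j : 'I_N.+1, (i <= j)%N -> H i j = 0.

Definition kappa_mx (R : realType) (N : nat) (sigma : R[i])
    (H : 'M[R]_N.+1) : 'M[R[i]]_N.+1 :=
  1%:M + sigma *: (Smx R[i] N *m map_mx (real_complex R) H).

(* [invmx A] is [A] when [A] is singular; [kappa_mx_unit] below shows that this
   case does not occur for strictly lower triangular [H]. *)
Definition kappa (R : realType) (N : nat) (sigma : R[i])
    (H : 'M[R]_N.+1) : R[i] :=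
  ((last_basis R[i] N)^T *m invmx (kappa_mx sigma H) *m onesv R[i] N) 0 0.

Lemma kappa_mx_unit (R : realType) (N : nat) (sigma : R[i])
    (H : 'M[R]_N.+1) :
  strictly_lower H -> kappa_mx sigma H \in unitmx.
Proof.
move=> Hlow.
have SH0 (i j : 'I_N.+1) : (i <= j)%N ->
    (Smx R[i] N *m map_mx (real_complex R) H) i j = 0.
  move=> leij; rewrite mxE big1 // => k _; rewrite !mxE.
  case: (leqP k i) => [leki|_]; last by rewrite mul0r.
  by rewrite Hlow ?rmorph0 ?mulr0 // (leq_trans leki leij).
have kE (i j : 'I_N.+1) : (i <= j)%N -> kappa_mx sigma H i j = (i == j)%:R.
  by move=> leij; rewrite mxE [X in X + _]mxE [X in _ + X]mxE SH0 // mulr0 addr0.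
rewrite unitmxE det_trig.
  by rewrite big1 ?unitr1 // => i _; rewrite kE // eqxx.
apply/is_trig_mxP => i j ltij.
by rewrite kE ?(ltnW ltij) // (_ : i == j = false) //; apply/negbTE; rewrite neq_ltn ltij.
Qed.

(* Main.v *)
Require Import Defs.
From mathcomp Require Import all_boot all_order all_algebra.
From mathcomp Require Import reals.
From mathcomp.real_closed Require Import complex.

(** Write [K] for [1 + sigma S H] and [K'] for [1 + sigma S H^A].  Since the
    all-ones vector is the first column of [S], [kappa sigma H] is the
    bottom-left entry of [K^-1 S].  The antitransposition is an
    anti-automorphism of the matrix ring; it fixes [S], because [S] is
    Toeplitz, and it fixes the bottom-left entry of every matrix, because that
    entry lies on the antidiagonal.  Hence [kappa sigma H] is also the
    bottom-left entry of [(K^-1 S)^A = S (K^A)^-1].  But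
    [K^A = 1 + sigma H^A S], so [S K^A = K' S] (push-through identity), that is
    [S (K^A)^-1 = K'^-1 S], whose bottom-left entry is [kappa sigma H^A].
    Strict lower triangularity of [H], which [H^A] inherits, makes [K] and [K']
    invertible. *)

Import GRing.Theory.
Local Open Scope ring_scope.

Lemma antitrE (F : nzRingType) (N : nat) (A : 'M[F]_N.+1) (i j : 'I_N.+1) :
  antitr A i j = A (rev_ord j) (rev_ord i).
Proof.
rewrite /antitr mxE (bigD1 (rev_ord j)) //= [X in _ + X]big1 => [|k nekj].
  rewrite [revmx _ _ _ j]mxE rev_ordK eqxx mulr1 addr0 mxE.
  rewrite (bigD1 (rev_ord i)) //= big1 => [|k neki].
    by rewrite !mxE eqxx mul1r addr0.
  by rewrite !mxE (negbTE neki) mul0r.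
rewrite [revmx _ _ _ j]mxE -(inj_eq rev_ord_inj) rev_ordK eq_sym.
by rewrite (negbTE nekj) mulr0.
Qed.

Lemma antitr1 (F : nzRingType) (N : nat) : antitr (1%:M : 'M[F]_N.+1) = 1%:M.
Proof.
by apply/matrixP => i j; rewrite antitrE !mxE (inj_eq rev_ord_inj) eq_sym.
Qed.

Lemma antitrD (F : nzRingType) (N : nat) (A B : 'M[F]_N.+1) :
  antitr (A + B) = antitr A + antitr B.
Proof. by apply/matrixP => i j; rewrite !(antitrE, mxE). Qed.

Lemma antitrZ (F : nzRingType) (N : nat) (a : F) (A : 'M[F]_N.+1) :
  antitr (a *: A) = a *: antitr A.
Proof. by apply/matrixP => i j; rewrite !(antitrE, mxE). Qed.

Lemma antitrM (F : comNzRingType) (N : nat) (A B : 'M[F]_N.+1) :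
  antitr (A *m B) = antitr B *m antitr A.
Proof.
apply/matrixP => i j; rewrite antitrE !mxE (reindex_inj rev_ord_inj).
by apply: eq_bigr => k _; rewrite !antitrE mulrC.
Qed.

Lemma antitr_map (F G : nzRingType) (f : F -> G) (N : nat) (A : 'M[F]_N.+1) :
  antitr (map_mx f A) = map_mx f (antitr A).
Proof. by apply/matrixP => i j; rewrite [RHS]mxE !antitrE mxE. Qed.

Lemma antitr_Smx (F : nzRingType) (N : nat) : antitr (Smx F N) = Smx F N.
Proof.
by apply/matrixP => i j; rewrite antitrE !mxE /= leq_sub2lE.
Qed.

Lemma antitr_bottom_left (F : nzRingType) (N : nat) (A : 'M[F]_N.+1) :
  antitr A ord_max ord0 = A ord_max ord0.
Proof.
by rewrite antitrE; congr (A _ _); apply: val_inj; rewrite /= ?subn1 ?subnn.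
Qed.

Lemma antitr_strictly_lower (F : nzRingType) (N : nat) (H : 'M[F]_N.+1) :
  strictly_lower H -> strictly_lower (antitr H).
Proof. by move=> Hlow i j leij; rewrite antitrE Hlow //= leq_sub2l. Qed.

(** For [S] fixed by the antitransposition, the left side is [S (K^A)^-1], so
    the hypothesis [S K^A = K' S] says that it equals [K'^-1 S]. *)
Lemma antitr_invmx_mul (F : comUnitRingType) (N : nat) (S K K' : 'M[F]_N.+1) :
  K \in unitmx -> K' \in unitmx -> antitr S = S ->
  S *m antitr K = K' *m S ->
  antitr (invmx K *m S) = invmx K' *m S.
Proof.
move=> unitK unitK' SA SK; rewrite antitrM SA.
(* Multiplying by [K'] on the left reduces the goal to [K' S (K^-1)^A = S],
   where [K' S = S K^A] and [K^A (K^-1)^A = (K^-1 K)^A = 1]. *)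
apply: (can_inj (mulKmx unitK')); rewrite mulKVmx // mulmxA.
by rewrite -SK -mulmxA -antitrM mulVmx // antitr1 mulmx1.
Qed.

(** Holds because the first column of [S] is the all-ones vector; a single
    entry on the antidiagonal is what the antitransposition preserves. *)
Lemma kappa_bottom_left (R : realType) (N : nat) (sigma : R[i])
    (H : 'M[R]_N.+1) :
  kappa sigma H = (invmx (kappa_mx sigma H) *m Smx R[i] N) ord_max ord0.
Proof.
rewrite /kappa /last_basis trmx_delta -rowE !mxE.
by apply: eq_bigr => k _; rewrite !mxE.
Qed.

(** Both sides are [S + sigma S H^A S]: this is the push-through identity. *)
Lemma Smx_antitr_kappa_mx (R : realType) (N : nat) (sigma : R[i])
    (H : 'M[R]_N.+1) :
  Smx R[i] N *m antitr (kappa_mx sigma H) =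
  kappa_mx sigma (antitr H) *m Smx R[i] N.
Proof.
rewrite /kappa_mx antitrD antitr1 antitrZ antitrM antitr_map antitr_Smx.
by rewrite mulmxDr mulmxDl mulmx1 mul1mx -scalemxAr -scalemxAl mulmxA.
Qed.

Theorem lemma8 (R : realType) (N : nat) (hN : (1 <= N)%N)
    (sigma : complex R) (H : 'M[R]_N.+1) (hH : strictly_lower H) :
  kappa sigma H = kappa sigma (antitr H).
Proof.
have unitK := kappa_mx_unit sigma hH.
have unitK' := kappa_mx_unit sigma (antitr_strictly_lower _ _ _ hH).
have conjK := antitr_invmx_mul _ _ _ _ _ unitK unitK' (antitr_Smx _ _)
  (Smx_antitr_kappa_mx _ _ _ _).
rewrite (kappa_bottom_left _ _ _ H) (kappa_bottom_left _ _ _ (antitr H)).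
by rewrite -[LHS]antitr_bottom_left conjK.
Qed.
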